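(* Let $r=\langle L\leftarrow K\rightarrow R\rangle$ be a rule in which $L$ and $R$ are totally labelled graphs and $K$ is partially labelled. Then for all totally labelled graphs $G,H$ over $\mathcal{L}$: $G\Rightarrow_r H$ if and only if $e(G)\Rightarrow_{e(r)}e(H)$, where $e(r)=\langle e(L)\leftarrow e(K)\rightarrow e(R)\rangle$ with the encoded inclusions.
   Context: Let $\mathcal{L}=(\mathcal{L}_V,\mathcal{L}_E)$ be a label alphabet of finite sets with $\mathcal{L}_V\cap\mathcal{L}_E=\emptyset$ and $\square\notin\mathcal{L}_V\cup\mathcal{L}_E$. A partially labelled graph is $G=(V,E,s,t,l,m)$ with finite $V,E$, total $s,t:E\to V$, partial node labelling $l:V\to\mathcal{L}_V$ and total edge labelling $m:E\to\mathcal{L}_E$; it is totally labelled if $l$ is total. Morphisms preserve sources, targets, edge labels, and node labels where defined in the domain. A rule $\langle L\leftarrow K\rightarrow R\rangle$ has $K$ a subgraph of $L$ and $R$ (inclusions). Application of a rule to a totally labelled $G$ via injective $g:L\to G$ satisfying the dangling condition (no edge outside $g(L)$ incident to $g(V_L\setminus V_K)$): delete $g(L\setminus K)$, make $g_V(v)$ unlabelled for every node $v\in V_K$ unlabelled in $K$; add disjointly $R\setminus K$ with labels and label each such $g_V(v)$ by $l_R(v)$; $G\Rightarrow_r M$ iff $M$ is isomorphic to the result for some such $g$. (When all graphs are totally labelled, this is ordinary DPO rewriting.) Encoding: for a partially labelled $G$ (assuming $V_G\cap E_G=\emptyset$) let $e(G)=(V,E,s,t,l,m)$ with $V=V_G$,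 $E=E_G\cup\{v\in V_G\mid l_G(v)\text{ defined}\}$, $s(e)=s_G(e),t(e)=t_G(e)$ for $e\in E_G$ and $s(v)=t(v)=v$ for the added loops $v$, $l(v)=\square$ for all nodes, $m(e)=m_G(e)$ for $e\in E_G$ and $m(v)=l_G(v)$ for added loops. This is a totally labelled graph over $e(\mathcal{L})=(\{\square\},\mathcal{L}_V\cup\mathcal{L}_E)$. For a morphism $g:G\to H$, $e(g)=(g'_V,g'_E)$ with $g'_V=g_V$, $g'_E(e)=g_E(e)$ for $e\in E_G$ and $g'_E(v)=g_V(v)$ for added loops $v$. *)

(* Defs.v *)
From mathcomp Require Import all_boot.

Set Implicit Arguments.
Unset Strict Implicit.
Unset Printing Implicit Defensive.

(* Partially labelled graphs over the alphabet (LV, LE); [nlab v = None] means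
   that the node [v] is unlabelled.  Node and edge labels are elements of
   different types, so the two label sets are disjoint by construction. *)
Record graph (LV LE : finType) := Graph {
  node : finType;
  edge : finType;
  src : edge -> node;
  tgt : edge -> node;
  nlab : node -> option LV;
  elab : edge -> LE
}.

Definition totally_labelled (LV LE : finType) (G : graph LV LE) : Prop :=
  forall v : node G, isSome (nlab v).

Record morphism (LV LE : finType) (G H : graph LV LE) := Morphism {
  nmap : node G -> node H;
  emap : edge G -> edge H;
  morph_src : forall e, src (emap e) = nmap (src e);
  morph_tgt : forall e, tgt (emap e) = nmap (tgt e);
  morph_nlab : forall v a, nlab v = Some a -> nlab (nmap v) = Some a;
  morph_elab : forall e, elab (emap e) = elab e
}.

Definition injective_morphism (LV LE : finType) (G H : graph LV LE)
    (f : morphism G H) : Prop :=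
  injective (nmap f) /\ injective (emap f).

(* A bijective morphism may still map an unlabelled node to a labelled one,
   hence the third condition. *)
Definition isomorphism (LV LE : finType) (G H : graph LV LE)
    (f : morphism G H) : Prop :=
  [/\ bijective (nmap f), bijective (emap f)
    & forall v, nlab v = None -> nlab (nmap f v) = None].

Definition isomorphic (LV LE : finType) (G H : graph LV LE) : Prop :=
  exists f : morphism G H, isomorphism f.

(* A rule L <- K -> R.  The carriers of distinct graphs are distinct types, so
   the inclusions of K in L and in R are given as injective morphisms.  A node
   of K may be unlabelled in K while being labelled in L or R. *)
Record rule (LV LE : finType) := Rule {
  lhs : graph LV LE;
  interface : graph LV LE;
  rhs : graph LV LE;
  incl_l : morphism interface lhs;
  incl_r : morphism interface rhs;
  incl_l_inj : injective_morphism incl_l;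
  incl_r_inj : injective_morphism incl_r
}.

(* The parts g(V_L \ V_K) and g(E_L \ E_K) of G. *)
Definition deleted_nodes (LV LE : finType) (r : rule LV LE) (G : graph LV LE)
    (g : morphism (lhs r) G) : {set node G} :=
  nmap g @: ~: (nmap (incl_l r) @: setT).

Definition deleted_edges (LV LE : finType) (r : rule LV LE) (G : graph LV LE)
    (g : morphism (lhs r) G) : {set edge G} :=
  emap g @: ~: (emap (incl_l r) @: setT).

Definition dangling_condition (LV LE : finType) (r : rule LV LE)
    (G : graph LV LE) (g : morphism (lhs r) G) : Prop :=
  forall e : edge G, e \notin emap g @: setT ->
    (src e \notin deleted_nodes g) /\ (tgt e \notin deleted_nodes g).

(* The nodes and edges of the result of applying r at g form the subset
   (G \ g(L \ K)) + (R \ K) of the disjoint union of G and R. *)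
Definition result_node_pred (LV LE : finType) (r : rule LV LE)
    (G : graph LV LE) (g : morphism (lhs r) G) (x : node G + node (rhs r)) :
    bool :=
  match x with
  | inl v => v \notin deleted_nodes g
  | inr w => w \notin nmap (incl_r r) @: setT
  end.

Definition result_edge_pred (LV LE : finType) (r : rule LV LE)
    (G : graph LV LE) (g : morphism (lhs r) G) (x : edge G + edge (rhs r)) :
    bool :=
  match x with
  | inl e => e \notin deleted_edges g
  | inr d => d \notin emap (incl_r r) @: setT
  end.

(* Where a node of R lies in the result: a node k of K lies at its image g(k)
   in G, a node of R \ K is a new node. *)
Definition locate (LV LE : finType) (r : rule LV LE) (G : graph LV LE)
    (g : morphism (lhs r) G) (w : node (rhs r)) : node G + node (rhs r) :=
  if [pick k | nmap (incl_r r) k == w] is Some k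
  then inl (nmap g (nmap (incl_l r) k)) else inr w.

Definition result_src (LV LE : finType) (r : rule LV LE) (G : graph LV LE)
    (g : morphism (lhs r) G) (x : edge G + edge (rhs r)) :
    node G + node (rhs r) :=
  match x with inl e => inl (src e) | inr d => locate g (src d) end.

Definition result_tgt (LV LE : finType) (r : rule LV LE) (G : graph LV LE)
    (g : morphism (lhs r) G) (x : edge G + edge (rhs r)) :
    node G + node (rhs r) :=
  match x with inl e => inl (tgt e) | inr d => locate g (tgt d) end.

(* The image in G of a node k unlabelled in K loses its label and takes the
   label of k in R; every other preserved node keeps its label. *)
Definition result_nlab (LV LE : finType) (r : rule LV LE) (G : graph LV LE)
    (g : morphism (lhs r) G) (x : node G + node (rhs r)) : option LV :=
  match x with
  | inl v =>
      if [pick k | (nmap g (nmap (incl_l r) k) == v) && ~~ isSome (nlab k)]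
        is Some k
      then nlab (nmap (incl_r r) k) else nlab v
  | inr w => nlab w
  end.

Definition result_elab (LV LE : finType) (r : rule LV LE) (G : graph LV LE)
    (x : edge G + edge (rhs r)) : LE :=
  match x with inl e => elab e | inr d => elab d end.

Lemma locate_result (LV LE : finType) (r : rule LV LE) (G : graph LV LE)
    (g : morphism (lhs r) G) (w : node (rhs r)) :
  injective_morphism g -> result_node_pred g (locate g w).
Proof.
move=> [gVinj _]; rewrite /locate; case: pickP => [k _|nk] /=.
  apply/imsetP => -[x]; rewrite inE => /imsetP xK /gVinj kx.
  by apply: xK; exists k.
by apply/imsetP => -[k _ wk]; move: (nk k); rewrite wk eqxx.
Qed.

Lemma preserved_edge (LV LE : finType) (r : rule LV LE) (G : graph LV LE)
    (g : morphism (lhs r) G) (e : edge G) :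
  injective_morphism g -> dangling_condition g -> e \notin deleted_edges g ->
  (src e \notin deleted_nodes g) /\ (tgt e \notin deleted_nodes g).
Proof.
move=> [gVinj _] dang ekept.
have [/imsetP[d _ ed]|/dang//] := boolP (e \in emap g @: setT).
have : d \in emap (incl_l r) @: setT.
  by apply: contraR ekept => dK; apply/imsetP; exists d; rewrite ?inE.
case/imsetP=> k _ dk; rewrite ed dk !morph_src !morph_tgt.
by split; apply/imsetP => -[x]; rewrite inE => /imsetP xK /gVinj kx;
  apply: xK; [exists (src k) | exists (tgt k)].
Qed.

Lemma result_src_ok (LV LE : finType) (r : rule LV LE) (G : graph LV LE)
    (g : morphism (lhs r) G) :
  injective_morphism g -> dangling_condition g ->
  forall x, result_edge_pred g x -> result_node_pred g (result_src g x).
Proof.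
move=> ginj dang [e|d] /= kept; last exact: locate_result.
by case: (preserved_edge ginj dang kept).
Qed.

Lemma result_tgt_ok (LV LE : finType) (r : rule LV LE) (G : graph LV LE)
    (g : morphism (lhs r) G) :
  injective_morphism g -> dangling_condition g ->
  forall x, result_edge_pred g x -> result_node_pred g (result_tgt g x).
Proof.
move=> ginj dang [e|d] /= kept; last exact: locate_result.
by case: (preserved_edge ginj dang kept).
Qed.

Definition result (LV LE : finType) (r : rule LV LE) (G : graph LV LE)
    (g : morphism (lhs r) G) (ginj : injective_morphism g)
    (dang : dangling_condition g) : graph LV LE :=
  @Graph LV LE
    {x : node G + node (rhs r) | result_node_pred g x}
    {x : edge G + edge (rhs r) | result_edge_pred g x}
    (fun e => exist _ (result_src g (val e))
                      (result_src_ok ginj dang (valP e)))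
    (fun e => exist _ (result_tgt g (val e))
                      (result_tgt_ok ginj dang (valP e)))
    (fun v => result_nlab g (val v))
    (fun e => result_elab (val e)).

Definition derives (LV LE : finType) (r : rule LV LE) (G M : graph LV LE) :
    Prop :=
  exists (g : morphism (lhs r) G) (ginj : injective_morphism g)
         (dang : dangling_condition g),
    isomorphic M (result ginj dang).

Definition defined_value (T : Type) (o : option T) : isSome o -> T :=
  match o return isSome o -> T with
  | Some a => fun _ => a
  | None => fun no => False_rect T (notF no)
  end.

(* The type [unit] plays the role of the one-element set of node labels, and
   the disjoint union [LV + LE] that of the set of edge labels; a node [v]
   labelled in G yields the loop [inr v], with [v] in a subtype of [node G]. *)
Definition encode (LV LE : finType) (G : graph LV LE) :
    graph unit (LV + LE)%type :=
  @Graph unit (LV + LE)%type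
    (node G)
    (edge G + {v : node G | isSome (nlab v)})%type
    (fun e => match e with inl d => src d | inr v => val v end)
    (fun e => match e with inl d => tgt d | inr v => val v end)
    (fun _ => Some tt)
    (fun e => match e with
              | inl d => inr (elab d)
              | inr v => inl (defined_value (valP v))
              end).

Lemma nmap_labelled (LV LE : finType) (G H : graph LV LE)
    (f : morphism G H) (v : node G) :
  isSome (nlab v) -> isSome (nlab (nmap f v)).
Proof. by case va: (nlab v) => [a|] // _; rewrite (morph_nlab f va). Qed.

Definition encode_emap (LV LE : finType) (G H : graph LV LE)
    (f : morphism G H) (e : edge (encode G)) : edge (encode H) :=
  match e with
  | inl d => inl (emap f d)
  | inr v => inr (exist _ (nmap f (val v)) (nmap_labelled f (valP v)))
  end.

Lemma defined_value_eq (T : Type) (o : option T) (ho : isSome o) :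
  o = Some (defined_value ho).
Proof. by case: o ho. Qed.

Lemma encode_src (LV LE : finType) (G H : graph LV LE) (f : morphism G H)
    (e : edge (encode G)) :
  src (encode_emap f e) = nmap f (src e) :> node (encode H).
Proof. by case: e => [d|v] //=; rewrite morph_src. Qed.

Lemma encode_tgt (LV LE : finType) (G H : graph LV LE) (f : morphism G H)
    (e : edge (encode G)) :
  tgt (encode_emap f e) = nmap f (tgt e) :> node (encode H).
Proof. by case: e => [d|v] //=; rewrite morph_tgt. Qed.

Lemma encode_nlab (LV LE : finType) (G H : graph LV LE) (f : morphism G H)
    (v : node (encode G)) (a : unit) :
  nlab v = Some a -> nlab (nmap f v : node (encode H)) = Some a.
Proof. by []. Qed.

Lemma encode_elab (LV LE : finType) (G H : graph LV LE) (f : morphism G H)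
    (e : edge (encode G)) : elab (encode_emap f e) = elab e.
Proof.
case: e => [d|[v hv]] /=; first by rewrite morph_elab.
congr inl; apply: Some_inj; rewrite -!defined_value_eq.
by rewrite (defined_value_eq hv); apply: morph_nlab; apply: defined_value_eq.
Qed.

Definition encode_morphism (LV LE : finType) (G H : graph LV LE)
    (f : morphism G H) : morphism (encode G) (encode H) :=
  @Morphism unit (LV + LE)%type (encode G) (encode H) (nmap f) (encode_emap f)
    (encode_src f) (encode_tgt f) (encode_nlab f) (encode_elab f).

Lemma encode_morphism_inj (LV LE : finType) (G H : graph LV LE)
    (f : morphism G H) :
  injective_morphism f -> injective_morphism (encode_morphism f).
Proof.
move=> [fV fE]; split => //= -[d|v] [d'|v'] //= [].
  by move/fE->.
by move/fV/val_inj->.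
Qed.

Definition encode_rule (LV LE : finType) (r : rule LV LE) :
    rule unit (LV + LE)%type :=
  Rule (encode_morphism_inj (incl_l_inj r)) (encode_morphism_inj (incl_r_inj r)).

(* Main.v *)
(* Edges and label loops of an encoded graph carry labels from different
   summands, so every morphism between encoded graphs comes from a unique
   morphism of the original graphs, and encoding reflects isomorphism.  It then
   suffices that encoding commutes with rule application: relabelling a
   preserved node corresponds to deleting its old loop (in [encode L] but not in
   [encode K]) and adding a new one (in [encode R] but not in [encode K]). *)

Require Import Defs.
From mathcomp Require Import all_boot.

Set Implicit Arguments.
Unset Strict Implicit.
Unset Printing Implicit Defensive.

(** * Isomorphism of partially labelled graphs *)

Lemma inj_surj_bij (T T' : finType) (f : T -> T') :
  injective f -> (forall y, exists x, f x = y) -> bijective f.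
Proof.
move=> finj fsurj; apply: inj_card_bij => //.
rewrite -(card_codom finj); apply: subset_leq_card.
by apply/subsetP => y _; have [x <-] := fsurj y; apply: codom_f.
Qed.

Lemma omap_defined_value (T U : Type) (f : T -> U) (o : option T)
    (ho : isSome o) : omap f o = Some (f (defined_value ho)).
Proof. by case: o ho. Qed.

Lemma isomorphic_sym (LV LE : finType) (A B : graph LV LE) :
  isomorphic A B -> isomorphic B A.
Proof.
case=> f [[gV fVK gVK] [gE fEK gEK] fnone].
have gS e : src (gE e) = gV (src e).
  by apply: (can_inj fVK); rewrite -morph_src gVK gEK.
have gT e : tgt (gE e) = gV (tgt e).
  by apply: (can_inj fVK); rewrite -morph_tgt gVK gEK.
(* The inverse preserves labels by the third condition on isomorphisms: an unlabelled preimage would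
   force [v] to be unlabelled. *)
have gN v a : nlab v = Some a -> nlab (gV v) = Some a.
  move=> va; case ga: (nlab (gV v)) => [b|].
    by have := morph_nlab f ga; rewrite gVK va.
  by move: (fnone _ ga); rewrite gVK va.
have gL e : elab (gE e) = elab e by rewrite -(morph_elab f) gEK.
exists (Morphism gS gT gN gL); split=> /=.
- by exists (nmap f).
- by exists (emap f).
- move=> v va; case ga: (nlab (gV v)) => [b|] //.
by move: (morph_nlab f ga); rewrite gVK va.
Qed.

Lemma isomorphic_trans (LV LE : finType) (A B C : graph LV LE) :
  isomorphic A B -> isomorphic B C -> isomorphic A C.
Proof.
case=> f [fV fE fnone] [g [gV gE gnone]].
have hS e : src (emap g (emap f e)) = nmap g (nmap f (src e)).
  by rewrite !morph_src.
have hT e : tgt (emap g (emap f e)) = nmap g (nmap f (tgt e)).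
  by rewrite !morph_tgt.
have hN v a : nlab v = Some a -> nlab (nmap g (nmap f v)) = Some a.
  by move=> va; do 2!apply: morph_nlab.
have hL e : elab (emap g (emap f e)) = elab e by rewrite !morph_elab.
exists (@Morphism _ _ A C (nmap g \o nmap f) (emap g \o emap f) hS hT hN hL).
split; [exact: bij_comp|exact: bij_comp|].
by move=> v va; apply: gnone; apply: fnone.
Qed.

(** * Morphisms between encoded graphs *)

Lemma morph_encode_edge (LV LE : finType) (A B : graph LV LE)
    (f : morphism (encode A) (encode B)) (d : edge A) :
  {e : edge B | emap f (inl d) = inl e}.
Proof.
have := morph_elab f (inl d); case: (emap f (inl d)) => [e|v] //= _.
by exists e.
Qed.

(** The label summand forces the image to be a loop; preservation of sources then fixes its node,
    and preservation of edge labels gives the equality of node labels. *)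
Lemma morph_encode_loop (LV LE : finType) (A B : graph LV LE)
    (f : morphism (encode A) (encode B)) (v : {v : node A | isSome (nlab v)}) :
  exists2 w : {w : node B | isSome (nlab w)},
    emap f (inr v) = inr w & val w = nmap f (val v) /\
    nlab (val w) = nlab (val v).
Proof.
have := morph_elab f (inr v); have := morph_src f (inr v).
case: (emap f (inr v)) => [e|w] //= wv [lab].
exists w => //; split => //.
by rewrite (defined_value_eq (valP w)) lab -defined_value_eq.
Qed.

Definition decode_emap (LV LE : finType) (A B : graph LV LE)
    (f : morphism (encode A) (encode B)) (d : edge A) : edge B :=
  sval (morph_encode_edge f d).

Lemma decode_emapE (LV LE : finType) (A B : graph LV LE)
    (f : morphism (encode A) (encode B)) (d : edge A) :
  emap f (inl d) = inl (decode_emap f d).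
Proof. exact: svalP (morph_encode_edge f d). Qed.

(** Pointwise agreement replaces the equality [f' = encode_morphism f], which would call for
    function extensionality. *)
Definition encodes (LV LE : finType) (A B : graph LV LE)
    (f : morphism A B) (f' : morphism (encode A) (encode B)) : Prop :=
  nmap f' =1 nmap f /\ emap f' =1 encode_emap f.

Lemma decode_morphism (LV LE : finType) (A B : graph LV LE)
    (f' : morphism (encode A) (encode B)) :
  exists f : morphism A B, encodes f f'.
Proof.
have fS d : src (decode_emap f' d) = nmap f' (src d).
  by have := morph_src f' (inl d); rewrite decode_emapE.
have fT d : tgt (decode_emap f' d) = nmap f' (tgt d).
  by have := morph_tgt f' (inl d); rewrite decode_emapE.
have fN (v : node A) a :
    nlab v = Some a -> nlab (nmap f' v : node B) = Some a.
  move=> va; have hv : isSome (nlab v) by rewrite va.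
  by have [w _ [/= <- ->]] := morph_encode_loop f' (exist _ v hv).
have fL d : elab (decode_emap f' d) = elab d.
  by have := morph_elab f' (inl d); rewrite decode_emapE => -[].
exists (@Morphism _ _ A B (nmap f') (decode_emap f') fS fT fN fL).
split=> // -[d|v] /=; first exact: decode_emapE.
have [w -> [wv _]] := morph_encode_loop f' v.
by congr inr; apply: val_inj.
Qed.

Lemma encodes_injective (LV LE : finType) (A B : graph LV LE)
    (f : morphism A B) (f' : morphism (encode A) (encode B)) :
  encodes f f' -> injective_morphism f' -> injective_morphism f.
Proof.
case=> eV eE [fV fE]; split=> [v w|d d'] eq.
  by apply: fV; rewrite !eV.
by apply: (@inl_inj _ {v : node A | isSome (nlab v)}); apply: fE; rewrite !eE /= eq.
Qed.

Lemma isomorphic_encode (LV LE : finType) (A B : graph LV LE) :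
  isomorphic A B <-> isomorphic (encode A) (encode B).
Proof.
split=> [[f [fV fE fnone]]|[f' [fV fE _]]].
  exists (encode_morphism f); split=> //=.
  apply: inj_surj_bij.
    by case: (encode_morphism_inj (conj (bij_inj fV) (bij_inj fE))).
  case: fV fE => gV _ gVK [gE _ gEK] [e|[w hw]].
    by exists (inl (gE e)); rewrite /= gEK.
  (* The loop at [w] has a preimage only if the preimage of [w] is labelled, which the third
     condition on isomorphisms provides. *)
  have hv : isSome (nlab (gV w)).
    case ga: (nlab (gV w)) => [//|].
    by move: (fnone _ ga) hw; rewrite gVK => ->.
  by exists (inr (exist _ (gV w) hv)); congr inr; apply: val_inj; rewrite /= gVK.
have [f ff'] := decode_morphism f'; have [eV eE] := ff'.
have [fVinj fEinj] := encodes_injective ff' (conj (bij_inj fV) (bij_inj fE)).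
case: fV fE => gV _ gVK [gE _ gEK].
exists f; split.
- by apply: inj_surj_bij => // w; exists (gV w); rewrite -eV gVK.
- apply: inj_surj_bij => // e; have := gEK (inl e); rewrite eE.
  by case: (gE (inl e)) => // d [<-]; exists d.
(* If the image of [v] were labelled, its loop would have a preimage under the edge bijection; by
   injectivity on nodes this is a loop at [v], so [v] would be labelled. *)
- move=> v va; case fa: (nlab (nmap f v)) => [a|] //.
  have hw : isSome (nlab (nmap f v)) by rewrite fa.
  have := gEK (inr (exist (fun w : node B => isSome (nlab w)) _ hw)); rewrite eE.
  case: (gE _) => // -[u hu] [/fVinj uv].
  by move: hu; rewrite uv va.
Qed.

(** * Node labels in the result of a rule application *)

Lemma locate_interface (LV LE : finType) (r : rule LV LE) (G : graph LV LE)
    (g : morphism (lhs r) G) (k : node (interface r)) :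
  locate g (nmap (incl_r r) k) = inl (nmap g (nmap (incl_l r) k)).
Proof.
rewrite /locate; case: pickP => [k' /eqP|/(_ k)]; last by rewrite eqxx.
by case: (incl_r_inj r) => rV _ /rV->.
Qed.

Lemma locate_new (LV LE : finType) (r : rule LV LE) (G : graph LV LE)
    (g : morphism (lhs r) G) (w : node (rhs r)) :
  w \notin nmap (incl_r r) @: setT -> locate g w = inr w.
Proof.
move=> wK; rewrite /locate; case: pickP => [k /eqP kw|//].
by case/negP: wK; rewrite -kw imset_f.
Qed.

Lemma result_nlab_unlabelled (LV LE : finType) (r : rule LV LE)
    (G : graph LV LE) (g : morphism (lhs r) G) (k : node (interface r)) :
  injective_morphism g -> nlab k = None ->
  result_nlab g (inl (nmap g (nmap (incl_l r) k))) = nlab (nmap (incl_r r) k).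
Proof.
case=> gV _ kn /=; case: pickP => [k' /andP[/eqP/gV kk' _]|/(_ k)].
  by case: (incl_l_inj r) kk' => lV _ /lV->.
by rewrite eqxx kn.
Qed.

Lemma result_nlab_kept (LV LE : finType) (r : rule LV LE)
    (G : graph LV LE) (g : morphism (lhs r) G) (v : node G) :
  (forall k, nmap g (nmap (incl_l r) k) = v -> isSome (nlab k)) ->
  result_nlab g (inl v) = nlab v.
Proof.
by move=> vk /=; case: pickP => [k /andP[/eqP/vk->]|].
Qed.

(** A node unlabelled in the interface takes its label from the right-hand side by construction; one
    labelled there has that same label in L, G and R, since morphisms preserve labels. *)
Lemma result_nlab_locate (LV LE : finType) (r : rule LV LE)
    (G : graph LV LE) (g : morphism (lhs r) G) (w : node (rhs r)) :
  injective_morphism g -> result_nlab g (locate g w) = nlab w.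
Proof.
move=> ginj; have [/imsetP[k _ ->]|wK] := boolP (w \in nmap (incl_r r) @: setT).
  rewrite locate_interface; case kn: (nlab k) => [a|].
    rewrite result_nlab_kept => [|k'].
      by rewrite (morph_nlab _ kn) (morph_nlab _ (morph_nlab _ kn)).
    case: ginj (incl_l_inj r) => gV _ [lV _] /gV/lV->.
    by rewrite kn.
  exact: result_nlab_unlabelled.
by rewrite locate_new.
Qed.

Lemma result_totally_labelled (LV LE : finType) (r : rule LV LE)
    (G : graph LV LE) (g : morphism (lhs r) G) (ginj : injective_morphism g)
    (dang : dangling_condition g) :
  totally_labelled (rhs r) -> totally_labelled G ->
  totally_labelled (result ginj dang).
Proof.
move=> hR hG [[v|w] _] /=; last exact: hR.
by case: pickP => [k _|_]; [apply: hR|apply: hG].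
Qed.

(** * Deletion and the dangling condition under encoding *)

Lemma encodes_deleted_nodes (LV LE : finType) (r : rule LV LE)
    (G : graph LV LE) (g : morphism (lhs r) G)
    (g' : morphism (lhs (encode_rule r)) (encode G)) :
  encodes g g' -> deleted_nodes g' = deleted_nodes g.
Proof. by case=> eV _; apply: eq_imset. Qed.

Lemma encodes_image_edge (LV LE : finType) (A B : graph LV LE)
    (f : morphism A B) (f' : morphism (encode A) (encode B)) (d : edge B) :
  encodes f f' ->
  ((inl d : edge (encode B)) \in emap f' @: setT) = (d \in emap f @: setT).
Proof.
case=> _ eE; apply/imsetP/imsetP => -[].
  by move=> [e|v] _; rewrite eE //= => -[->]; exists e.
by move=> e _ ->; exists (inl e); rewrite ?eE.
Qed.

Lemma encodes_image_loop (LV LE : finType) (A B : graph LV LE)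
    (f : morphism A B) (f' : morphism (encode A) (encode B))
    (w : {w : node B | isSome (nlab w)}) :
  encodes f f' ->
  reflect (exists2 v, isSome (nlab v) & nmap f v = val w)
    ((inr w : edge (encode B)) \in emap f' @: setT).
Proof.
case=> _ eE; apply: (iffP imsetP) => -[].
  by move=> [e|[v hv]] _; rewrite eE //= => -[->]; exists v.
move=> v hv vw; exists (inr (exist _ v hv)) => //.
by rewrite eE /=; congr inr; apply: val_inj.
Qed.

Lemma encode_encodes (LV LE : finType) (A B : graph LV LE) (f : morphism A B) :
  encodes f (encode_morphism f).
Proof. by []. Qed.

Lemma encodes_deleted_edge (LV LE : finType) (r : rule LV LE)
    (G : graph LV LE) (g : morphism (lhs r) G)
    (g' : morphism (lhs (encode_rule r)) (encode G)) (e : edge G) :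
  encodes g g' ->
  ((inl e : edge (encode G)) \in deleted_edges g') = (e \in deleted_edges g).
Proof.
case=> _ eE; apply/imsetP/imsetP => -[].
  move=> [d|v]; rewrite inE eE //.
  by rewrite (encodes_image_edge _ (encode_encodes _)) => dK [->]; exists d; rewrite ?inE.
move=> d; rewrite inE => dK ->; exists (inl d); last by rewrite eE.
by rewrite inE (encodes_image_edge _ (encode_encodes _)).
Qed.

(* A loop standing for a label is deleted either with its node, or because its
   node is preserved but unlabelled in the interface. *)
Lemma encodes_deleted_loop (LV LE : finType) (r : rule LV LE)
    (G : graph LV LE) (g : morphism (lhs r) G)
    (g' : morphism (lhs (encode_rule r)) (encode G))
    (v : {v : node G | isSome (nlab v)}) :
  totally_labelled (lhs r) -> injective_morphism g -> encodes g g' ->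
  reflect (val v \in deleted_nodes g \/
           exists2 k, nlab k = None & nmap g (nmap (incl_l r) k) = val v)
    ((inr v : edge (encode G)) \in deleted_edges g').
Proof.
move=> hL [gV _] [_ eE]; apply: (iffP imsetP).
  case=> -[d|[w hw]]; rewrite inE eE // => wK [->] /=.
  have [/imsetP[k _ wk]|wK'] := boolP (w \in nmap (incl_l r) @: setT).
    right; exists k; last by rewrite wk.
    case ka: (nlab k) => [a|] //; case/(encodes_image_loop _ (encode_encodes _)): wK.
    by exists k; rewrite ?ka.
  by left; apply: imset_f; rewrite inE.
(* Common core of both cases: if no labelled interface node lies over [w], the loop at [w], present
   because L is totally labelled, is outside the encoded interface. *)
have loop w : nmap g w = val v ->
    (forall k, nmap (incl_l r) k = w -> nlab k = None) ->
    exists2 e, e \in ~: (emap (incl_l (encode_rule r)) @: setT) &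
      inr v = emap g' e.
  move=> wv wk; exists (inr (exist _ w (hL w))).
    rewrite inE; apply/(encodes_image_loop _ (encode_encodes _)) => -[k hk /= /wk kn].
    by rewrite kn in hk.
  by rewrite eE /=; congr inr; apply: val_inj.
case=> [/imsetP[w wK wv]|[k kn kv]].
  apply: (loop w) => // k kw; case/negP: (wK : w \in ~: _).
  by rewrite inE -kw imset_f.
apply: loop kv _ => k'; by case: (incl_l_inj r) => lV _ /lV->.
Qed.

(** Loops impose no further constraint: as L is totally labelled, the loop at the image of a node of
    L is itself in the image of the match, so a loop outside that image never sits at a deleted
    node. *)
Lemma encodes_dangling (LV LE : finType) (r : rule LV LE)
    (G : graph LV LE) (g : morphism (lhs r) G)
    (g' : morphism (lhs (encode_rule r)) (encode G)) :
  totally_labelled (lhs r) -> encodes g g' ->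
  dangling_condition g' <-> dangling_condition g.
Proof.
move=> hL gg'; rewrite /dangling_condition; split=> dang.
  move=> e eg; have := dang (inl e).
  by rewrite (encodes_image_edge _ gg') (encodes_deleted_nodes gg'); apply.
case=> [e|v]; first by rewrite (encodes_image_edge _ gg') (encodes_deleted_nodes gg'); apply: dang.
move=> vg; rewrite (encodes_deleted_nodes gg') /=.
suff vd : val v \notin deleted_nodes g by [].
apply: contra vg => /imsetP[w _ wv]; apply/(encodes_image_loop _ gg').
by exists w.
Qed.

(** * Matching the edges of the two results *)

(** Subtype proofs are stripped and a loop is recorded by its node. Together with [encoded_item]
    this gives a common type in which edges of the two results are compared. *)
Definition underlying_item (LV LE : finType) (r : rule LV LE)
    (G : graph LV LE) (g : morphism (lhs r) G) (ginj : injective_morphism g)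
    (dang : dangling_condition g) (y : edge (encode (result ginj dang))) :
    (edge G + edge (rhs r)) + (node G + node (rhs r)) :=
  match y with inl e => inl (val e) | inr v => inr (val (val v)) end.

Lemma underlying_item_inj (LV LE : finType) (r : rule LV LE)
    (G : graph LV LE) (g : morphism (lhs r) G) (ginj : injective_morphism g)
    (dang : dangling_condition g) :
  injective (@underlying_item _ _ r G g ginj dang).
Proof.
case=> [e|v] [e'|v'] //= [].
  by move/val_inj->.
by move/val_inj/val_inj->.
Qed.

(* A loop of [encode (rhs r)] at an interface node becomes the label of the
   preserved node of G under that interface node, hence [locate]. *)
Definition encoded_item (LV LE : finType) (r : rule LV LE)
    (G : graph LV LE) (g : morphism (lhs r) G)
    (x : edge (encode G) + edge (encode (rhs r))) :
    (edge G + edge (rhs r)) + (node G + node (rhs r)) :=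
  match x with
  | inl (inl e) => inl (inl e)
  | inl (inr v) => inr (inl (val v))
  | inr (inl d) => inl (inr d)
  | inr (inr w) => inr (locate g (val w))
  end.

(** A kept loop sits at a kept node, since deleting a node deletes its loop, and the result is
    totally labelled, so that node has a loop again. The sigma type lets the edge map of the
    isomorphism be projected out. *)
Lemma result_edge_pred_item (LV LE : finType) (r : rule LV LE)
    (G : graph LV LE) (g : morphism (lhs r) G)
    (g' : morphism (lhs (encode_rule r)) (encode G))
    (ginj : injective_morphism g) (dang : dangling_condition g)
    (x : edge (encode G) + edge (encode (rhs r))) :
  totally_labelled (lhs r) -> totally_labelled (rhs r) ->
  totally_labelled G -> encodes g g' -> result_edge_pred g' x ->
  {y : edge (encode (result ginj dang)) |
    underlying_item y = encoded_item g x}.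
Proof.
move=> hL hR hG gg'.
  have tot : totally_labelled (result ginj dang).
    exact: result_totally_labelled.
have loop (v : node (result ginj dang)) :
    {y : edge (encode (result ginj dang)) | underlying_item y = inr (val v)}.
  by exists (inr (exist _ v (tot v))).
case: x => [[e|v]|[d|w]] /= kept.
- have ek : result_edge_pred g (inl e) by rewrite /= -(encodes_deleted_edge _ gg').
  by exists (inl (exist _ (inl e) ek)).
- have vk : result_node_pred g (inl (val v)).
    by apply: contra kept => vd; apply/(encodes_deleted_loop v hL ginj gg'); left.
  exact: loop (exist (fun x => result_node_pred g x) _ vk).
- have dk : result_edge_pred g (inr d).
    by rewrite /= -(encodes_image_edge _ (encode_encodes _)).
  by exists (inl (exist _ (inr d) dk)).
- exact: loop (exist (fun x => result_node_pred g x) _ (locate_result _ ginj)).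
Qed.

Lemma locate_inj (LV LE : finType) (r : rule LV LE) (G : graph LV LE)
    (g : morphism (lhs r) G) : injective_morphism g -> injective (locate g).
Proof.
move=> [gV _] w w'; have [lV _] := incl_l_inj r.
have [/imsetP[k _ ->]|wK] := boolP (w \in nmap (incl_r r) @: setT);
  have [/imsetP[k' _ ->]|wK'] := boolP (w' \in nmap (incl_r r) @: setT);
  rewrite ?locate_interface ?locate_new //.
- by case=> /gV/lV->.
- by case.
Qed.

Lemma locate_inl (LV LE : finType) (r : rule LV LE) (G : graph LV LE)
    (g : morphism (lhs r) G) (w : node (rhs r)) (v : node G) :
  locate g w = inl v ->
  exists2 k, nmap (incl_r r) k = w & nmap g (nmap (incl_l r) k) = v.
Proof.
have [/imsetP[k _ ->]|wK] := boolP (w \in nmap (incl_r r) @: setT).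
  by rewrite locate_interface => -[<-]; exists k.
by rewrite locate_new.
Qed.

Lemma encoded_item_inj (LV LE : finType) (r : rule LV LE)
    (G : graph LV LE) (g : morphism (lhs r) G)
    (g' : morphism (lhs (encode_rule r)) (encode G))
    (x y : edge (encode G) + edge (encode (rhs r))) :
  totally_labelled (lhs r) -> injective_morphism g -> encodes g g' ->
  result_edge_pred g' x -> result_edge_pred g' y ->
  encoded_item g x = encoded_item g y -> x = y.
Proof.
move=> hL ginj gg'.
(* A kept loop and a new loop never meet: the new loop sits over a node that
   is unlabelled in the interface, whose old loop has been deleted. *)
have disj (v : {v : node G | isSome (nlab v)})
    (w : {w : node (rhs r) | isSome (nlab w)}) :
    result_edge_pred g' (inl (inr v)) -> result_edge_pred g' (inr (inr w)) ->
    inl (val v) <> locate g (val w).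
  move=> /= vk wk /esym/locate_inl[k kw kv].
  case/negP: vk; apply/(encodes_deleted_loop v hL ginj gg'); right.
  exists k => //; case ka: (nlab k) => [a|] //.
  case/(encodes_image_loop _ (encode_encodes _)): wk.
  by exists k; rewrite ?ka.
case: x y => [[e|v]|[d|w]] [[e'|v']|[d'|w']] xk yk //=.
- by case=> ->.
- by case=> /val_inj->.
- by case=> /(disj _ _ xk yk).
- by case=> ->.
- by case=> /esym/(disj _ _ yk xk).
- by case=> /(locate_inj ginj)/val_inj->.
Qed.

(** The loop at a preserved node stems from R when an interface node unlabelled in K lies over it,
    and from G otherwise; the loop at a new node stems from R. *)
Lemma encoded_item_surj (LV LE : finType) (r : rule LV LE)
    (G : graph LV LE) (g : morphism (lhs r) G)
    (g' : morphism (lhs (encode_rule r)) (encode G))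
    (ginj : injective_morphism g) (dang : dangling_condition g)
    (y : edge (encode (result ginj dang))) :
  totally_labelled (lhs r) -> totally_labelled (rhs r) ->
  totally_labelled G -> encodes g g' ->
  exists2 x, result_edge_pred g' x & encoded_item g x = underlying_item y.
Proof.
move=> hL hR hG gg'; case: y => [[[e|d] kept]|[[[v|w] kept] lab]] /=.
- by exists (inl (inl e)) => //=; rewrite (encodes_deleted_edge _ gg').
- by exists (inr (inl d)) => //=; rewrite (encodes_image_edge _ (encode_encodes _)).
(* This is the test by which [result_nlab] decides on relabelling. *)
- pose over k := (nmap g (nmap (incl_l r) k) == v) && ~~ isSome (nlab k).
  have [k /andP[/eqP kv kn]|none] := pickP over.
    exists (inr (inr (exist _ (nmap (incl_r r) k) (hR _)))) => /=.
      apply/(encodes_image_loop _ (encode_encodes _)) => -[k' hk /=].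
      by case: (incl_r_inj r) => rV _ /rV kk'; rewrite -kk' hk in kn.
    by rewrite locate_interface kv.
  exists (inl (inr (exist _ v (hG v)))) => //=.
  apply/(encodes_deleted_loop _ hL ginj gg') => -[|[k kn kv]] /=.
    exact/negP.
  by have := none k; rewrite /over kv eqxx kn.
- exists (inr (inr (exist _ w (hR w)))) => /=; last by rewrite locate_new.
  apply/(encodes_image_loop _ (encode_encodes _)) => -[k _ kw].
  by case/negP: (kept); rewrite -[w]kw imset_f.
Qed.

(** Incidence and labels depend on the underlying item alone, which reduces the morphism laws of the
    edge map to computations on [encoded_item]. *)
Lemma underlying_item_src (LV LE : finType) (r : rule LV LE)
    (G : graph LV LE) (g : morphism (lhs r) G) (ginj : injective_morphism g)
    (dang : dangling_condition g) (y : edge (encode (result ginj dang))) :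
  val (src y) =
    match underlying_item y with inl e => result_src g e | inr v => v end.
Proof. by case: y. Qed.

Lemma underlying_item_tgt (LV LE : finType) (r : rule LV LE)
    (G : graph LV LE) (g : morphism (lhs r) G) (ginj : injective_morphism g)
    (dang : dangling_condition g) (y : edge (encode (result ginj dang))) :
  val (tgt y) =
    match underlying_item y with inl e => result_tgt g e | inr v => v end.
Proof. by case: y. Qed.

Lemma underlying_item_elab (LV LE : finType) (r : rule LV LE)
    (G : graph LV LE) (g : morphism (lhs r) G) (ginj : injective_morphism g)
    (dang : dangling_condition g) (y : edge (encode (result ginj dang))) :
  Some (elab y) =
    match underlying_item y with
    | inl e => Some (inr (result_elab e))
    | inr v => omap inl (result_nlab g v)
    end.
Proof.
case: y => [e|v] //=.
exact/esym/omap_defined_value.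
Qed.

(** * Encoding commutes with rule application *)

Lemma result_encode (LV LE : finType) (r : rule LV LE)
    (G : graph LV LE) (g : morphism (lhs r) G)
    (g' : morphism (lhs (encode_rule r)) (encode G))
    (ginj : injective_morphism g) (dang : dangling_condition g)
    (ginj' : injective_morphism g') (dang' : dangling_condition g') :
  totally_labelled (lhs r) -> totally_labelled (rhs r) ->
  totally_labelled G -> encodes g g' ->
  isomorphic (result ginj' dang') (encode (result ginj dang)).
Proof.
move=> hL hR hG gg'.
have nodeE x : result_node_pred g' x = result_node_pred g x.
  by case: x => [v|w] //=; rewrite (encodes_deleted_nodes gg').
have nodeP (x : node (result ginj' dang')) : result_node_pred g (val x).
  by rewrite -nodeE; apply: (valP x).
pose fV (x : node (result ginj' dang')) : node (encode (result ginj dang)) :=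
  exist _ (val x) (nodeP x).
(* An edge goes to the one with the same item; it is unique by [underlying_item_inj]. *)
pose fE (x : edge (result ginj' dang')) : edge (encode (result ginj dang)) :=
  sval (result_edge_pred_item ginj dang hL hR hG gg' (valP x)).
have fEP x : underlying_item (fE x) = encoded_item g (val x).
  exact: svalP (result_edge_pred_item ginj dang hL hR hG gg' (valP x)).
have locateE w : locate g' w = locate g w.
  have [/imsetP[k _ ->]|wK] := boolP (w \in nmap (incl_r r) @: setT).
    rewrite (locate_interface g' k) locate_interface.
    by rewrite (proj1 gg').
  by rewrite (locate_new g) // (locate_new g').
have fS x : src (fE x) = fV (src x).
  apply: val_inj; rewrite underlying_item_src fEP.
  by case: x => [[[e|v]|[d|w]] p] //=; rewrite locateE.
have fT x : tgt (fE x) = fV (tgt x).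
  apply: val_inj; rewrite underlying_item_tgt fEP.
  by case: x => [[[e|v]|[d|w]] p] //=; rewrite locateE.
have fN x a : nlab x = Some a -> nlab (fV x) = Some a by case: a.
have fL x : elab (fE x) = elab x.
  apply: Some_inj; rewrite underlying_item_elab fEP.
  case: x => [[[e|v]|[d|w]] p] //=.
    (* A kept loop must carry the label of its node in the result: relabelling the node would have
       required deleting the loop. *)
    transitivity (omap inl (nlab (val v)) : option (LV + LE)); last first.
      exact: omap_defined_value.
    congr (omap inl _); apply: (@result_nlab_kept _ _ r G g) => k kv; case kn: (nlab k) => //.
    by case/negP: p; apply/(encodes_deleted_loop v hL ginj gg'); right; exists k.
  rewrite result_nlab_locate //.
  exact: omap_defined_value.
exists (Morphism fS fT fN fL); split=> /=.
- apply: inj_surj_bij => [x y [/val_inj]//|[x p]].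
  have p' : result_node_pred g' x by rewrite nodeE.
  by exists (exist _ x p'); apply: val_inj.
- apply: inj_surj_bij => [x y xy|y].
    apply: val_inj; apply: (encoded_item_inj hL ginj gg' (valP x) (valP y)).
    by rewrite -!fEP xy.
  have [x xk xy] := encoded_item_surj y hL hR hG gg'.
  by exists (exist _ x xk); apply: underlying_item_inj; rewrite fEP.
(* Relabelled or not, every node carries [tt], so none is unlabelled. *)
- move=> [[v|w] p] //=; by case: pickP.
Qed.

Theorem mainTheorem18 (LV LE : finType) (r : rule LV LE)
    (hL : totally_labelled (lhs r)) (hR : totally_labelled (rhs r))
    (G H : graph LV LE)
    (hG : totally_labelled G) (hH : totally_labelled H) :
  derives r G H <-> derives (encode_rule r) (encode G) (encode H).
Proof.
split=> [[g [ginj [dang HM]]]|[g' [ginj' [dang' HM]]]].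
  have gg' : @encodes _ _ (lhs r) G g (encode_morphism g) := encode_encodes g.
  have ginj' := encode_morphism_inj ginj.
  have [_ /(_ dang) dang'] := encodes_dangling (r := r) hL gg'.
  exists (encode_morphism g : morphism (lhs (encode_rule r)) (encode G)).
  exists ginj', dang'.
  apply: (isomorphic_trans (B := encode (result ginj dang))).
    by case: (isomorphic_encode H (result ginj dang)) => + _; apply.
  by apply: isomorphic_sym; apply: result_encode.
(* An arbitrary match of the encoded rule comes from a match of [r], whose result is then compared
   with [H] after encoding. *)
have [g gg'] := decode_morphism (A := lhs r) g'.
have ginj := encodes_injective gg' ginj'.
have [/(_ dang') dang _] := encodes_dangling hL gg'.
exists g, ginj, dang; apply/isomorphic_encode.
by apply: isomorphic_trans HM _; apply: result_encode.
Qed.
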